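(* Let $n\ge 4$ and let $S=\{x,y,z,w\}$ be a set of four distinct vertices of $D_n$ such that the vertices of $S$ lie in exactly three clusters of $D_n$. Then there exist $n-1$ internally disjoint $S$-trees in $D_n$.
   Context: The $n$-dimensional dual cube $D_n$ has vertex set all $(2n-1)$-bit binary strings $u_1u_2\cdots u_{2n-1}$. Two vertices $u,v$ are adjacent iff they differ in exactly one bit position $i$, and moreover: if $1\le i\le n-1$ then $u_{2n-1}=v_{2n-1}=0$; if $n\le i\le 2n-2$ then $u_{2n-1}=v_{2n-1}=1$; (if $i=2n-1$ there is no further condition). A cluster of class $0$ is a set of all vertices with last bit $0$ and a fixed value of the bits in positions $n,\dots,2n-2$; a cluster of class $1$ is a set of all vertices with last bit $1$ and a fixed value of the bits in positions $1,\dots,n-1$. The clusters partition $V(D_n)$. For $S\subseteq V(G)$, an $S$-tree is a subtree of $G$ whose vertex set contains $S$; a family of $S$-trees $T_1,\dots,T_m$ is internally disjoint if the trees are pairwise edge-disjoint and $V(T_i)\cap V(T_j)=S$ for all $i\ne j$. *)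

(* Defs.v *)
From mathcomp Require Import all_boot.
Set Implicit Arguments. Unset Strict Implicit. Unset Printing Implicit Defensive.

Definition dcvert (n : nat) := ((2 * n - 1).-tuple bool)%type.

(* bit v i = u_i, with 1-based position i (1 <= i <= 2n-1). *)
Definition bit n (v : dcvert n) (i : nat) : bool := nth false v i.-1.

Definition lastbit n (v : dcvert n) : bool := bit v (2 * n - 1).

Definition dc_adj n (u v : dcvert n) : bool :=
  [exists i : 'I_(2 * n - 1),
     let p := i.+1 in
     [&& [forall j : 'I_(2 * n - 1), (bit u j.+1 != bit v j.+1) == (j == i)],
         (p <= n - 1) ==> (~~ lastbit u && ~~ lastbit v) &
         ((n <= p) && (p <= 2 * n - 2)) ==> (lastbit u && lastbit v)]].

Definition same_cluster n (u v : dcvert n) : bool :=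
  (lastbit u == lastbit v) &&
  (if lastbit u
   then [forall i : 'I_(2 * n - 1), (1 <= i.+1 <= n - 1) ==> (bit u i.+1 == bit v i.+1)]
   else [forall i : 'I_(2 * n - 1), (n <= i.+1 <= 2 * n - 2) ==> (bit u i.+1 == bit v i.+1)]).

Definition cluster n (v : dcvert n) : {set dcvert n} := [set u | same_cluster u v].

Definition subgraph n := ({set dcvert n} * {set {set dcvert n}})%type.

Definition erel n (E : {set {set dcvert n}}) : rel (dcvert n) :=
  fun x y => [set x; y] \in E.

Definition is_subgraph n (G : subgraph n) : Prop :=
  forall e, e \in G.2 -> exists u v, [/\ e = [set u; v], u \in G.1, v \in G.1 & dc_adj u v].

Definition connected_sg n (G : subgraph n) : Prop :=
  forall u v, u \in G.1 -> v \in G.1 -> connect (erel G.2) u v.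

Definition acyclic_sg n (G : subgraph n) : Prop :=
  forall s : seq (dcvert n), uniq s -> 3 <= size s -> ~~ cycle (erel G.2) s.

Definition is_subtree n (G : subgraph n) : Prop :=
  [/\ is_subgraph G, G.1 != set0, connected_sg G & acyclic_sg G].

Definition is_S_tree n (S : {set dcvert n}) (G : subgraph n) : Prop :=
  is_subtree G /\ S \subset G.1.

Definition internally_disjoint_S_trees n m (S : {set dcvert n})
  (T : 'I_m -> subgraph n) : Prop :=
  (forall i, is_S_tree S (T i)) /\
  (forall i j, i != j -> [disjoint (T i).2 & (T j).2] /\ (T i).1 :&: (T j).1 = S).

(* Main.v *)
Require Import Defs.
From HB Require Import structures.
From mathcomp Require Import all_boot zify.

(*
  Write a vertex as (c, k, p): its class, the name of its cluster, its position in the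
  cluster. Let x and y be the two vertices in a common cluster (c, b0), at positions a1
  and a2. The i-th tree leaves x along coordinate i to position a1 + e_i and reaches y
  inside the cluster by the i-th of n - 1 internally disjoint paths from a1 to a2. From a1
  + e_i it crosses to the cluster (~c, a1 + e_i), which it uses whole; from there it
  enters each remaining cluster of class c at position a1 + e_i and follows the i-th path
  to the vertex of S in it. A vertex of S of class ~c is reached from an auxiliary whole
  cluster (c, k + e_i), by the i-th of the disjoint paths from position k in its cluster.
  Small adjustments are needed when (~c, a1 + e_i) itself contains a vertex of S. Since
  the vertex sets so obtained pairwise meet in S only, it remains to take spanning trees,
  letting just one of them use edges inside S.
*)

Set Implicit Arguments.
Unset Strict Implicit.
Unset Printing Implicit Defensive.

(** * Packing trees from connected vertex sets *)

Lemma erel_sym n (E : {set {set dcvert n}}) : symmetric (erel E).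
Proof. by move=> u v; rewrite /erel setUC. Qed.

(** The rest of the cycle leads from [v] along [q] back to [u] and replaces the edge between them;
    as [q] is nonempty, this detour is not that edge itself. *)
Lemma edge_on_cycle_redundant n (E : {set {set dcvert n}}) u v (q : seq (dcvert n)) :
  uniq [:: u, v & q] -> q != [::] -> cycle (erel E) [:: u, v & q] ->
  forall a b, erel E a b -> connect (erel (E :\ [set u; v])) a b.
Proof.
move=> /= /andP[]; rewrite inE negb_or => /andP[nuv uq] /andP[vq _] qn0.
rewrite rcons_path => /andP[_ /andP[pq luq]].
have sym := sym_connect_sym (@erel_sym n (E :\ [set u; v])).
have Cvu : connect (erel (E :\ [set u; v])) v u.
  apply/connectP; exists (rcons q u); last by rewrite last_rcons.
  rewrite rcons_path; apply/andP; split.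
    (* The edges along [q] do not touch [u], so they survive the removal. *)
    apply: (sub_in_path (P := predC1 u)) pq => [a b|].
      rewrite !inE => au bu ab; rewrite /erel !inE [_ \in E]ab andbT.
      apply/eqP => /setP/(_ u); rewrite !inE eqxx /=.
      by rewrite ![u == _]eq_sym (negbTE au) (negbTE bu).
    rewrite /= eq_sym nuv; apply/allP => a aq /=.
    by apply: contraNneq uq => <-.
  (* The closing edge joins [u] to the last vertex of [q], which is not [v]. *)
  rewrite /erel !inE; apply/andP; split=> //.
  case: q qn0 luq uq vq {pq} => // b q _ luq uq vq.
  have lv : last v (b :: q) != v.
    by apply: contraNneq vq => <- /=; apply: mem_last.
  have lu : last v (b :: q) != u.
    by apply: contraNneq uq => <- /=; apply: mem_last.
  apply/eqP => /setP/(_ (last v (b :: q))).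
  by rewrite !inE eqxx /= (negbTE lv) (negbTE lu).
move=> a b eab; case: (eqVneq [set a; b] [set u; v]) => [eq|ne]; last first.
  by apply: connect1; rewrite /erel !inE ne.
have : a \in [set u; v] by rewrite -eq !inE eqxx.
have : b \in [set u; v] by rewrite -eq !inE eqxx orbT.
have : u \in [set a; b] by rewrite eq !inE eqxx.
have : v \in [set a; b] by rewrite eq !inE eqxx orbT.
rewrite !inE => h1 h2 /orP[]/eqP-> /orP[]/eqP-> //; by rewrite ?connect0 // sym.
Qed.

(** An inclusion-minimal edge set that still connects the vertices is acyclic, since an edge of a
    cycle could be dropped. *)
Lemma spanning_tree n (G : subgraph n) :
  is_subgraph G -> G.1 != set0 -> connected_sg G ->
  exists E : {set {set dcvert n}}, E \subset G.2 /\ is_subtree (G.1, E).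
Proof.
case: G => V E0 /= sub Vn0 con.
pose cn (E : {set {set dcvert n}}) := [forall u in V, forall v in V, connect (erel E) u v].
have cnP (E : {set {set dcvert n}}) : reflect (connected_sg (V, E)) (cn E).
  apply: (iffP forall_inP) => [h u v uV vV|h u uV]; first by have /forall_inP/(_ v vV) := h u uV.
  by apply/forall_inP => v vV; apply: h.
have [E /minsetP[cE Emin] sE] := @minset_exists _ cn E0 (introT (cnP _) con).
exists E; split=> //; split=> //=.
- by move=> e eE; apply: sub; apply: (subsetP sE).
- exact/cnP.
move=> [|u [|v [|b q]]] // us _; apply/negP => cyc.
have red := edge_on_cycle_redundant us isT cyc.
have uvE : [set u; v] \in E by move: cyc => /= /andP[].
have := Emin (E :\ [set u; v]) _ (subD1set _ _).
move=> h; move: uvE; rewrite -h ?setD11 //.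
apply/cnP => a a' aV a'V; apply: (connect_sub red).
by move/cnP: cE; apply.
Qed.

(* Two members of the family meet only in [S], so they can only share edges inside [S];
   [F] singles out the one member allowed to use those. *)
Lemma trees_of_connected_sets n m (S : {set dcvert n}) (x : dcvert n)
    (W : 'I_m -> {set dcvert n}) (F : pred 'I_m) :
  x \in S ->
  (forall i, S \subset W i) ->
  (forall i j, i != j -> W i :&: W j = S) ->
  (forall i j, F i -> F j -> i = j) ->
  (forall i u, u \in W i ->
     connect [rel u v | [&& u \in W i, v \in W i, dc_adj u v &
                          F i || ~~ ((u \in S) && (v \in S))]] x u) ->
  exists T : 'I_m -> subgraph n, internally_disjoint_S_trees S T.
Proof.
move=> xS SW WW FF con.
pose ed i (p : dcvert n * dcvert n) := [&& p.1 \in W i, p.2 \in W i, dc_adj p.1 p.2 &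
                          F i || ~~ ((p.1 \in S) && (p.2 \in S))].
pose E i := [set [set p.1; p.2] | p in [pred p | ed i p]].
have Tex i : exists E' : {set {set dcvert n}}, E' \subset E i /\ is_subtree (W i, E').
  apply: (@spanning_tree n (W i, E i)) => /=.
  - move=> e /imsetP[[u v]]; rewrite inE /= => /and4P[uW vW uv _] ->.
    by exists u, v.
  - by apply/set0Pn; exists x; apply: (subsetP (SW i)).
  - have c u : u \in W i -> connect (erel (E i)) x u.
      move=> /con; apply: connect_sub => a b /= ab; apply: connect1.
      by apply/imsetP; exists (a, b).
    move=> u v /= uW vW; apply: (connect_trans (y := x)); last exact: c.
    by rewrite (sym_connect_sym (@erel_sym n _)) c.
have [T TP] : exists T : 'I_m -> {set {set dcvert n}}, 
    forall i, T i \subset E i /\ is_subtree (W i, T i).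
  exact: (fin_all_exists Tex).
exists (fun i => (W i, T i)); split=> [i|i j ij] /=.
  by split; [case: (TP i)|exact: SW].
split; last exact: WW.
rewrite -setI_eq0; apply/eqP/setP => e; rewrite !inE; apply/negP => /andP[ei ej].
have /imsetP[[u v]] := subsetP (TP i).1 _ ei.
have /imsetP[[u' v']] := subsetP (TP j).1 _ ej.
rewrite !inE /= => /and4P[uj vj _ Fj] e1 /and4P[ui vi _ Fi] e2.
(* A shared edge has both ends in [W i :&: W j], that is, in [S]; then [F i] and [F j] both hold and
   force [i = j]. *)
have Se a : a \in e -> a \in S.
  move=> ae; rewrite -(WW i j ij) inE; apply/andP; split.
    by move: ae; rewrite e2 !inE => /orP[]/eqP->.
  by move: ae; rewrite e1 !inE => /orP[]/eqP->.
have fi : F i by move: Fi; rewrite (Se u) ?(Se v) ?e2 ?inE ?eqxx ?orbT ?orbF //.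
have fj : F j by move: Fj; rewrite (Se u') ?(Se v') ?e1 ?inE ?eqxx ?orbT ?orbF //.
by move: ij; rewrite (FF i j) ?eqxx.
Qed.

(** * Fans in the hypercube *)

Notation cube m := {ffun 'I_m -> bool}.

Definition flip m (p : cube m) (i : 'I_m) : cube m :=
  [ffun j => (j == i) (+) p j].

Definition cube_adj m (p q : cube m) : bool := [exists i, q == flip p i].

Definition cube_adj_in m (A : {set cube m}) : rel (cube m) :=
  [rel p q | [&& p \in A, q \in A & cube_adj p q]].

Lemma flipK m (p : cube m) i : flip (flip p i) i = p.
Proof. by apply/ffunP => j; rewrite !ffunE addKb. Qed.

Lemma flip_neq m (p : cube m) i : flip p i != p.
Proof. by apply/eqP => /ffunP/(_ i); rewrite ffunE eqxx; case: (p i). Qed.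

Lemma flip_inj m (p : cube m) : injective (flip p).
Proof.
move=> i j /ffunP/(_ i); rewrite !ffunE eqxx.
by case: eqP => // _; case: (p i).
Qed.

Lemma cube_adjC m : symmetric (@cube_adj m).
Proof.
by move=> p q; apply/existsP/existsP => -[i /eqP->]; exists i; rewrite flipK.
Qed.

Lemma cube_adj_flip m (p : cube m) i : cube_adj p (flip p i).
Proof. by apply/existsP; exists i. Qed.

(** Stage [t] of a walk from [a] to [b] that corrects coordinate [j] in the step from time [r j] to
    the next. *)
Definition walk m (r : 'I_m -> nat) (a b : cube m) (t : nat) : cube m :=
  [ffun j => if r j < t then b j else a j].

(** As [r] is injective, consecutive stages differ in at most one coordinate; where none changes,
    the walk pauses. *)
Lemma walk_conn m (r : 'I_m -> nat) a b (A : {set cube m}) s :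
  injective r -> (forall t, t <= s -> walk r a b t \in A) ->
  connect (cube_adj_in A) a (walk r a b s).
Proof.
move=> rinj; elim: s => [_|s IH sA].
  by rewrite (_ : walk _ _ _ _ = a) //; apply/ffunP => j; rewrite ffunE.
apply: connect_trans (IH _) _ => [t ts|]; first by apply: sA; apply: leqW.
case: (eqVneq (walk r a b s) (walk r a b s.+1)) => [<- //|ne].
apply: connect1; rewrite /cube_adj_in /= !sA //=; apply/existsP.
have [j] : exists j, walk r a b s j != walk r a b s.+1 j.
  by apply/existsP; apply: contraNT ne; rewrite negb_exists => /forallP h;
     apply/eqP/ffunP => j; apply/eqP; have := h j; rewrite negbK.
rewrite !ffunE ltnS => hj; exists j; apply/eqP/ffunP => k; rewrite !ffunE ltnS.
case: eqP => [->|/eqP kj] /=.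
  by move: hj; case: (r j < s); case: (r j <= s); case: (a j); case: (b j).
have rjs : r j = s by move: hj; case: (ltngtP (r j) s) => // _; rewrite eqxx.
have rks : r k != s by apply: contraNneq kj => rks; apply/eqP/rinj; rewrite rjs.
by rewrite leq_eqVlt (negbTE rks).
Qed.

Lemma cube_conn m (p q : cube m) : connect (cube_adj_in setT) p q.
Proof.
rewrite [q](_ : _ = walk (@nat_of_ord m) p q m).
  by apply: walk_conn => [|t _]; [apply: val_inj|rewrite inE].
by apply/ffunP => j; rewrite ffunE ltn_ord.
Qed.

(** The number of steps forward from [i] to [j] around a cycle of length [m]; used as a rank in
    [walk], it lists the coordinates cyclically from [i]. *)
Definition cyc_dist m (i j : 'I_m) : nat := if i <= j then j - i else m + j - i.

Lemma cyc_dist_inj m (i : 'I_m) : injective (cyc_dist i).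
Proof.
move=> j k h; apply: ord_inj; move: h (ltn_ord i) (ltn_ord j) (ltn_ord k).
by rewrite /cyc_dist; case: (leqP i j); case: (leqP i k); lia.
Qed.

Lemma cyc_dist_lt m (i j : 'I_m) : cyc_dist i j < m.
Proof.
move: (ltn_ord i) (ltn_ord j); rewrite /cyc_dist.
by case: (leqP i j); lia.
Qed.

(* The [i]-th of [m] internally disjoint paths from [a] to [a'], without its start [a]:
   flip coordinate [i], then correct the other coordinates in cyclic order from [i], and
   coordinate [i] last. *)
HB.lock Definition fan m (a a' : cube m) (i : 'I_m) : {set cube m} :=
  a' |: [set walk (cyc_dist i) (flip a i) [ffun j => if j == i then ~~ a i else a' j] t
        | t : 'I_m.+1].

Lemma fanP m (a a' : cube m) i p :
  reflect (p = a' \/ exists t, p = [ffun j => if j == i then ~~ a i else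
                                     if cyc_dist i j < t then a' j else a j])
          (p \in fan a a' i).
Proof.
have E t : walk (cyc_dist i) (flip a i) [ffun j => if j == i then ~~ a i else a' j] t =
   [ffun j => if j == i then ~~ a i else if cyc_dist i j < t then a' j else a j].
  by apply/ffunP => j; rewrite !ffunE; case: eqP => [->|]; rewrite ?if_same.
rewrite fan.unlock; apply: (iffP setU1P) => -[->|]; [by left| |by left|].
  by move=> /imsetP[t _ ->]; right; exists t; rewrite E.
(* All ranks are below [m], so capping the time at [m] changes nothing. *)
move=> [t ->]; right; apply/imsetP; exists (inord (minn t m)) => //.
rewrite E inordK ?ltnS ?geq_minr //; apply/ffunP => j; rewrite !ffunE.
by rewrite leq_min cyc_dist_lt andbT.
Qed.

Lemma fan_end m (a a' : cube m) i : a' \in fan a a' i.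
Proof. by apply/fanP; left. Qed.

Lemma fan_start m (a a' : cube m) i : flip a i \in fan a a' i.
Proof.
apply/fanP; right; exists 0; apply/ffunP => j; rewrite !ffunE.
by case: eqP => [->|].
Qed.

(** Every stage of the walk differs from [a] in coordinate [i], so only the end can be [a]. The case
    [a = a'] is allowed; the fan then consists of [a] and [flip a i]. *)
Lemma fan_avoid m (a a' : cube m) i : a \in fan a a' i -> a = a'.
Proof.
by move=> /fanP[//|[t /ffunP/(_ i)]]; rewrite ffunE eqxx; case: (a i).
Qed.

(** At a common stage [p], coordinate [i] is flipped, so the [j]-th walk has already corrected it to
    [a' i]; likewise with [i] and [j] exchanged. It remains to treat a third coordinate [k]. *)
Lemma fan_disjoint m (a a' : cube m) i j p :
  i != j -> p \in fan a a' i -> p \in fan a a' j -> p = a'.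
Proof.
move=> ij /fanP[//|[t pt]] /fanP[//|[s ps]].
have pi : p i = ~~ a i by rewrite pt ffunE eqxx.
have pj : p j = ~~ a j by rewrite ps ffunE eqxx.
have lt_i : (cyc_dist j i < s) /\ a' i = ~~ a i.
  by move: pi; rewrite ps ffunE (negbTE ij); case: ltnP => //; case: (a i).
have lt_j : (cyc_dist i j < t) /\ a' j = ~~ a j.
  by move: pj; rewrite pt ffunE eq_sym (negbTE ij); case: ltnP => //; case: (a j).
apply/ffunP => k.
case: (eqVneq k i) => [->|ki]; first by rewrite pi lt_i.2.
case: (eqVneq k j) => [->|kj]; first by rewrite pj lt_j.2.
have := congr1 (fun f : cube m => f k) pt.
rewrite ffunE (negbTE ki); case: ltnP => // ht _.
have := congr1 (fun f : cube m => f k) ps.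
rewrite ffunE (negbTE kj); case: ltnP => // hs _.
(* If neither walk had corrected [k], it would come after [j] counting from [i] and after [i]
   counting from [j], which no cyclic order permits. *)
move: (leq_trans lt_i.1 hs) (leq_trans lt_j.1 ht) ij ki kj; rewrite -!val_eqE /=.
move: (ltn_ord i) (ltn_ord j) (ltn_ord k); rewrite /cyc_dist.
by case: (leqP i j); case: (leqP j i); case: (leqP i k); case: (leqP j k); lia.
Qed.

Lemma fan_conn m (a a' : cube m) i p :
  p \in fan a a' i -> connect (cube_adj_in (fan a a' i)) (flip a i) p.
Proof.
set b := [ffun j => if j == i then ~~ a i else a' j] : cube m.
have wA t : t <= m -> walk (cyc_dist i) (flip a i) b t \in fan a a' i.
  move=> tm; rewrite fan.unlock; apply/setU1P; right; apply/imsetP.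
  by exists (inord t); rewrite ?inordK.
have wC t : t <= m ->
    connect (cube_adj_in (fan a a' i)) (flip a i) (walk (cyc_dist i) (flip a i) b t).
  move=> tm; apply: walk_conn => [|u ut]; first exact: cyc_dist_inj.
  by apply: wA; apply: leq_trans tm.
rewrite {1}fan.unlock => /setU1P[->|/imsetP[t _ ->]]; last by apply: wC; rewrite -ltnS.
have wm : walk (cyc_dist i) (flip a i) b m = b.
  by apply/ffunP => j; rewrite ffunE cyc_dist_lt.
have := wC m (leqnn m); have := wA m (leqnn m); rewrite wm => bA bC.
apply: connect_trans bC _.
(* The last stage [b] agrees with [a'] except possibly in coordinate [i], so at most one flip is
   left. *)
case: (eqVneq a' b) => [-> //|ne]; apply: connect1.
rewrite /cube_adj_in /= bA fan_end cube_adjC /=; apply/existsP; exists i.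
apply/eqP/ffunP => j; rewrite !ffunE; case: eqP => [->|] //=.
have : a' i != b i.
  apply: contraNneq ne => e; apply/eqP/ffunP => k; rewrite ffunE.
  by case: eqP => [->|//]; rewrite e ffunE eqxx.
by rewrite ffunE eqxx; case: (a i); case: (a' i).
Qed.

(** * The dual cube in coordinates *)

Lemma connect_homo (T T' : finType) (f : T -> T') (e : rel T) (e' : rel T') :
  (forall x y, e x y -> connect e' (f x) (f y)) ->
  forall x y, connect e x y -> connect e' (f x) (f y).
Proof.
move=> ee' x y /connectP[p]; elim: p x => [x _ -> //|z p IH x /= /andP[xz pz] yE].
exact: connect_trans (ee' _ _ xz) (IH _ pz yE).
Qed.

(* The vertex [(c, k, p)] has class [c]; [k] names its cluster and [p] is its position
   there. A cross edge changes the class and exchanges the roles of [k] and [p]. *)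
Notation dvert m := (bool * cube m * cube m)%type.

Definition dadj m (u v : dvert m) : bool :=
  if u.1.1 == v.1.1 then (u.1.2 == v.1.2) && cube_adj u.2 v.2
  else (v.1.2 == u.2) && (v.2 == u.1.2).

Lemma dadjC m : symmetric (@dadj m).
Proof.
move=> [[c k] p] [[c' k'] p']; rewrite /dadj /= eq_sym.
by case: eqP => _; [rewrite eq_sym cube_adjC | rewrite andbC eq_sym [k' == _]eq_sym].
Qed.

(** * Packings by connected vertex sets in coordinates *)

Definition tree_rel m (S W : {set dvert m}) (b : bool) : rel (dvert m) :=
  fun u v => [&& u \in W, v \in W, dadj u v & b || ~~ ((u \in S) && (v \in S))].

Lemma tree_relC m (S W : {set dvert m}) b : symmetric (tree_rel S W b).
Proof.
by move=> u v; rewrite /tree_rel dadjC andbCA [(u \in S) && _]andbC.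
Qed.

(** The hypotheses of [trees_of_connected_sets] in coordinates. The flag [F i] passed to [tree_rel]
    permits edges with both ends in [S]. *)
Definition packable m (S : {set dvert m}) : Prop :=
  exists x (W : 'I_m -> {set dvert m}) (F : pred 'I_m),
  [/\ x \in S, forall i, S \subset W i,
      forall i j, i != j -> W i :&: W j \subset S,
      forall i j, F i -> F j -> i = j &
      forall i u, u \in W i -> connect (tree_rel S (W i) (F i)) x u].

Section Connectivity.
Variables (m : nat) (S W : {set dvert m}) (b : bool).

(** [A] holds at most one position of [S], so no edge inside it joins two vertices of [S], and the
    flag does not matter. *)
Lemma cluster_conn c k (A : {set cube m}) :
  (forall p, p \in A -> (c, k, p) \in W) ->
  (forall p q, p \in A -> q \in A -> (c, k, p) \in S -> (c, k, q) \in S -> p = q) ->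
  forall p q, connect (cube_adj_in A) p q ->
  connect (tree_rel S W b) (c, k, p) (c, k, q).
Proof.
move=> AW AS; apply: (@connect_homo _ _ (fun p => (c, k, p))) => p q.
rewrite /cube_adj_in /= => /and3P[pA qA pq]; apply: connect1.
rewrite /tree_rel !AW //= /dadj /= !eqxx pq /=; apply/orP; right.
apply/negP => /andP[pS qS]; move: pq; rewrite (AS p q) //.
by move=> /existsP[i /eqP e]; have := flip_neq q i; rewrite -e eqxx.
Qed.

Lemma full_conn c k p q :
  (forall p, (c, k, p) \in W) -> (forall p, (c, k, p) \notin S) ->
  connect (tree_rel S W b) (c, k, p) (c, k, q).
Proof.
move=> kW kS; apply: (@cluster_conn _ _ setT); [by []| |exact: cube_conn].
by move=> p' q' _ _ h; have := kS p'; rewrite h.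
Qed.

Lemma fan_cluster_conn c k a a' i :
  (forall p, p \in fan a a' i -> (c, k, p) \in W) ->
  (forall p, p \in fan a a' i -> (c, k, p) \in S -> p = a') ->
  forall p, p \in fan a a' i ->
  connect (tree_rel S W b) (c, k, flip a i) (c, k, p).
Proof.
move=> fW fS p pf; apply: (cluster_conn fW); last exact: fan_conn.
by move=> p' q' hp hq /(fS _ hp)-> /(fS _ hq)->.
Qed.

Lemma flip_edge_conn c k p i :
  (c, k, p) \in W -> (c, k, flip p i) \in W ->
  b || ~~ (((c, k, p) \in S) && ((c, k, flip p i) \in S)) ->
  connect (tree_rel S W b) (c, k, p) (c, k, flip p i).
Proof.
move=> h1 h2 h; apply: connect1; rewrite /tree_rel h1 h2 h.
by rewrite /dadj /= !eqxx cube_adj_flip.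
Qed.

Lemma cross_conn c k p :
  (c, k, p) \in W -> (~~ c, p, k) \in W ->
  b || ~~ (((c, k, p) \in S) && ((~~ c, p, k) \in S)) ->
  connect (tree_rel S W b) (c, k, p) (~~ c, p, k).
Proof.
move=> h1 h2 h; apply: connect1; rewrite /tree_rel h1 h2 h.
by rewrite /dadj /= !eqxx; case: (c).
Qed.

Lemma cross_conn_sym c k p :
  (c, k, p) \in W -> (~~ c, p, k) \in W ->
  b || ~~ (((c, k, p) \in S) && ((~~ c, p, k) \in S)) ->
  connect (tree_rel S W b) (~~ c, p, k) (c, k, p).
Proof. by rewrite (sym_connect_sym (@tree_relC _ _ _ _)); exact: cross_conn. Qed.

End Connectivity.

(** This serves the cluster with two vertices of [S]. The fan avoids [a], so only the first edge can
    join them, and only if [flip a i = a'], which is the value of the flag. *)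
Lemma rooted_fan_conn m (S W : {set dvert m}) c k a a' i :
  a != a' ->
  (forall p, p \in a |: fan a a' i -> (c, k, p) \in W) ->
  (forall p, (c, k, p) \in S -> p = a \/ p = a') ->
  forall p, p \in a |: fan a a' i ->
  connect (tree_rel S W (flip a i == a')) (c, k, a) (c, k, p).
Proof.
move=> aa' fW kS p /setU1P[->//|pf].
have fW' q : q \in fan a a' i -> (c, k, q) \in W by move=> h; apply/fW/setU1P; right.
apply: (@connect_trans _ _ (c, k, flip a i)); last first.
  apply: fan_cluster_conn pf => // q qf /kS[|//] qa.
  by move: qf; rewrite qa => /fan_avoid.
apply: flip_edge_conn; [by apply/fW/setU1P; left|exact/fW'/fan_start|].
case: eqVneq => //= ne; apply/negP => /andP[_ /kS[]] /eqP; last by rewrite (negbTE ne).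
by rewrite (negbTE (flip_neq _ _)).
Qed.

(** [R i c k] is the set of positions that the [i]-th vertex set occupies in the cluster [(c, k)],
    so intersections can be checked one cluster at a time. *)
Lemma region_packable m (S : {set dvert m}) x (F : pred 'I_m)
    (R : 'I_m -> bool -> cube m -> {set cube m}) :
  x \in S ->
  (forall i c k p, (c, k, p) \in S -> p \in R i c k) ->
  (forall i j c k p, i != j -> p \in R i c k -> p \in R j c k -> (c, k, p) \in S) ->
  (forall i j, F i -> F j -> i = j) ->
  (forall i c k p, p \in R i c k ->
     connect (tree_rel S [set u | u.2 \in R i u.1.1 u.1.2] (F i)) x (c, k, p)) ->
  packable S.
Proof.
move=> xS SR RR FF con; exists x, (fun i => [set u | u.2 \in R i u.1.1 u.1.2]), F.
split=> // [i|i j ij|i [[c k] p]]; last by rewrite inE => /con.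
  by apply/subsetP => -[[c k] p] /SR h; rewrite inE h.
by apply/subsetP => -[[c k] p]; rewrite !inE /= => /andP[]; apply: RR.
Qed.

(** * The three distributions of the clusters over the classes *)

Lemma packable_three_alike m (c : bool) (b0 b1 b2 a1 a2 a3 a4 : cube m) :
  a1 != a2 -> b1 != b0 -> b2 != b0 -> b1 != b2 ->
  packable [set (c, b0, a1); (c, b0, a2); (c, b1, a3); (c, b2, a4)].
Proof.
move=> a12 b10 b20 b12; set S := [set _; _; _; _].
have nc : (~~ c == c) = false by case: (c).
have b21 : b2 != b1 by rewrite eq_sym.
have N := (nc, negbTE b10, negbTE b20, negbTE b12, negbTE b21).
(* The whole cluster [flip a1 i] of class [~~ c] is free of [S]; it meets [b1] and [b2] at position
   [flip a1 i], where the [i]-th fans from [a1] begin. *)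
pose R i c' k : {set cube m} :=
  if c' == c then
    if k == b0 then a1 |: fan a1 a2 i else
    if k == b1 then fan a1 a3 i else
    if k == b2 then fan a1 a4 i else set0
  else if k == flip a1 i then setT else set0.
(* At most one neighbour [flip a1 i] equals [a2], so at most one tree gets the flag. *)
apply: (@region_packable _ _ (c, b0, a1) (fun i => flip a1 i == a2) R).
- by rewrite !(inE, eqxx).
- move=> i c' k p; rewrite !inE => /orP[/orP[/orP[]|]|] /eqP[-> -> ->];
  by rewrite /R !(N, eqxx) /= ?inE ?fan_end ?eqxx ?orbT.
- move=> i j c' k p ij; rewrite /R; case: (eqVneq c' c) => [->|_].
    case: (eqVneq k b0) => [->|_].
      move=> /setU1P[->|pi]; first by rewrite !(inE, eqxx).
      move=> /setU1P[->|pj]; first by rewrite !(inE, eqxx).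
      by rewrite (fan_disjoint ij pi pj) !(inE, eqxx, orbT).
    case: (eqVneq k b1) => [->|_] => [pi pj|].
      by rewrite (fan_disjoint ij pi pj) !(inE, eqxx, orbT).
    case: (eqVneq k b2) => [->|_] => [pi pj|]; last by rewrite inE.
    by rewrite (fan_disjoint ij pi pj) !(inE, eqxx, orbT).
  case: (eqVneq k (flip a1 i)) => [->|_]; last by rewrite inE.
  case: (eqVneq (flip a1 i) (flip a1 j)) => [/flip_inj e|_]; last by rewrite !inE.
  by rewrite e eqxx in ij.
- by move=> i j /eqP ei /eqP ej; apply: (@flip_inj _ a1); rewrite ei ej.
move=> i; set W := [set _ | _].
have C0 p : p \in a1 |: fan a1 a2 i ->
    connect (tree_rel S W (flip a1 i == a2)) (c, b0, a1) (c, b0, p).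
  apply: rooted_fan_conn => // {}p; first by move=> h; rewrite inE /= /R !eqxx.
  rewrite !(inE, xpair_eqE, eqxx) /= ![b0 == _]eq_sym !N /= !orbF.
  by case/orP=> /eqP; [left|right].
have Wn k p : k = flip a1 i -> (~~ c, k, p) \in W.
  by move=> ->; rewrite inE /= /R nc eqxx inE.
have Sn k p : (~~ c, k, p) \notin S by rewrite !(inE, xpair_eqE) nc.
have C1 q : connect (tree_rel S W (flip a1 i == a2)) (c, b0, a1) (~~ c, flip a1 i, q).
  apply: connect_trans (C0 (flip a1 i) _) _; first by rewrite setU1r ?fan_start.
  apply: connect_trans (cross_conn _ (Wn _ _ erefl) _) _.
  - by rewrite inE /= /R !eqxx setU1r ?fan_start.
  - by rewrite (negbTE (Sn _ _)) andbF orbT.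
  by apply: full_conn => // p; apply: Wn.
have C2 p : p \in fan a1 a3 i ->
    connect (tree_rel S W (flip a1 i == a2)) (c, b0, a1) (c, b1, p).
  have W1 q : q \in fan a1 a3 i -> (c, b1, q) \in W by move=> h; rewrite inE /= /R !(N, eqxx).
  move=> pf; apply: connect_trans (C1 b1) _.
  apply: connect_trans (cross_conn_sym (W1 _ (fan_start _ _ _)) (Wn _ _ erefl) _) _.
    by rewrite (negbTE (Sn _ _)) andbF orbT.
  apply: fan_cluster_conn pf => // q _.
  by rewrite !(inE, xpair_eqE, eqxx) !N !(andbF, orbF) /= => /eqP.
have C3 p : p \in fan a1 a4 i ->
    connect (tree_rel S W (flip a1 i == a2)) (c, b0, a1) (c, b2, p).
  have W1 q : q \in fan a1 a4 i -> (c, b2, q) \in W by move=> h; rewrite inE /= /R !(N, eqxx).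
  move=> pf; apply: connect_trans (C1 b2) _.
  apply: connect_trans (cross_conn_sym (W1 _ (fan_start _ _ _)) (Wn _ _ erefl) _) _.
    by rewrite (negbTE (Sn _ _)) andbF orbT.
  apply: fan_cluster_conn pf => // q _.
  by rewrite !(inE, xpair_eqE, eqxx) !N !(andbF, orbF) /= => /eqP.
move=> c' k p; rewrite {1}/R; case: (eqVneq c' c) => [->|cc].
  case: eqP => [-> /C0 //|_]; case: eqP => [-> /C2 //|_].
  by case: eqP => [-> /C3 //|_]; rewrite inE.
have -> : c' = ~~ c by case: (c') (c) cc => [] [].
by case: eqP => [-> _|_]; [apply: C1|rewrite inE].
Qed.

(** Clusters of equal class are never adjacent, so each tree uses a whole cluster [(c, flip e i)] as
    a bridge to [(~~ c, a4)], which it enters at [flip e i], the start of a fan from [e] to [b4].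
    The conditions on [e] keep the bridges off [b0] and [b1]. *)
Lemma packable_two_and_one m (c : bool) (b0 b1 e a1 a2 a3 a4 b4 : cube m) :
  a1 != a2 -> b1 != b0 ->
  (forall i, flip e i != b0) -> (forall i, flip e i != b1) ->
  packable [set (c, b0, a1); (c, b0, a2); (c, b1, a3); (~~ c, a4, b4)].
Proof.
move=> a12 b10 eb0 eb1; set S := [set _; _; _; _].
have nc : (~~ c == c) = false by case: (c).
have cn : (c == ~~ c) = false by case: (c).
have N := (nc, cn, negbTE b10).
(* The neighbour of [a1] through which the tree leaves [b0]; the class [~~ c] cluster [a4]
   contains a vertex of [S], so [a1] itself replaces it there. *)
pose al i := if flip a1 i == a4 then a1 else flip a1 i.
have al4 i : al i != a4.
  rewrite /al; case: ifP => [/eqP<-|->//]; by rewrite eq_sym flip_neq.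
have al_inj : injective al.
  move=> i j; rewrite /al; case: eqP => [ei|_]; case: eqP => [ej|_].
  - by move=> _; apply: (@flip_inj _ a1); rewrite ei ej.
  - by move=> /esym/eqP; rewrite (negbTE (flip_neq _ _)).
  - by move=> /eqP; rewrite (negbTE (flip_neq _ _)).
  - exact: flip_inj.
(* When [flip a1 i = a4], the tree enters [b1] at [a1] and steps on to [flip a1 i]; hence the extra
   position [a1]. *)
pose R i c' k : {set cube m} :=
  if c' == c then
    if k == b0 then a1 |: fan a1 a2 i else
    if k == b1 then [set p | (p \in fan a1 a3 i) || (flip a1 i == a4) && (p == a1)] else
    if k == flip e i then setT else set0
  else
    if k == a4 then fan e b4 i else
    if k == al i then setT else set0.
apply: (@region_packable _ _ (c, b0, a1) (fun i => flip a1 i == a2) R).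
- by rewrite !(inE, eqxx).
- move=> i c' k p; rewrite !inE => /orP[/orP[/orP[]|]|] /eqP[-> -> ->];
  by rewrite /R !(N, eqxx) /= ?inE ?fan_end ?eqxx ?orbT.
- move=> i j c' k p ij; rewrite /R; case: (eqVneq c' c) => [->|cc].
    case: (eqVneq k b0) => [->|_].
      move=> /setU1P[->|pi]; first by rewrite !(inE, eqxx).
      move=> /setU1P[->|pj]; first by rewrite !(inE, eqxx).
      by rewrite (fan_disjoint ij pi pj) !(inE, eqxx, orbT).
    case: (eqVneq k b1) => [->|_].
      (* The position [a1] is added for at most one index, and it lies on another fan only if
         [a1 = a3], a position of [S]. *)
      rewrite !in_set => /orP[pi|/andP[/eqP ei /eqP pi]].
        move=> /orP[pj|/andP[_ /eqP pj]].
          by rewrite (fan_disjoint ij pi pj) !(inE, eqxx, orbT).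
        by move: pi; rewrite pj => /fan_avoid->; rewrite !(inE, eqxx, orbT).
      move=> /orP[pj|/andP[/eqP ej _]].
        by move: pj; rewrite pi => /fan_avoid->; rewrite !(inE, eqxx, orbT).
      by move: ij; rewrite (@flip_inj _ a1 i j) ?eqxx // ei ej.
    case: (eqVneq k (flip e i)) => [->|_]; last by rewrite inE.
    case: (eqVneq (flip e i) (flip e j)) => [/flip_inj eij|_]; last by rewrite !inE.
    by rewrite eij eqxx in ij.
  have -> : c' = ~~ c by case: (c') (c) cc => [] [].
  case: (eqVneq k a4) => [->|_] => [pi pj|].
    by rewrite (fan_disjoint ij pi pj) !(inE, eqxx, orbT).
  case: (eqVneq k (al i)) => [->|_]; last by rewrite inE.
  case: (eqVneq (al i) (al j)) => [/al_inj eij|_]; last by rewrite !inE.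
  by rewrite eij eqxx in ij.
- by move=> i j /eqP ei /eqP ej; apply: (@flip_inj _ a1); rewrite ei ej.
move=> i; set W := [set _ | _].
have C0 p : p \in a1 |: fan a1 a2 i ->
    connect (tree_rel S W (flip a1 i == a2)) (c, b0, a1) (c, b0, p).
  apply: rooted_fan_conn => // {}p; first by move=> h; rewrite inE /= /R !eqxx.
  rewrite !(inE, xpair_eqE, eqxx) /= ![b0 == _]eq_sym !N /= !orbF.
  by case/orP=> /eqP; [left|right].
have Wn p : (~~ c, al i, p) \in W.
  by rewrite inE /= /R nc (negbTE (al4 i)) eqxx inE.
have Sn p : (~~ c, al i, p) \notin S.
  by rewrite !(inE, xpair_eqE) !N (negbTE (al4 i)) ?andbF.
have We p : (c, flip e i, p) \in W.
  by rewrite inE /= /R eqxx (negbTE (eb0 i)) (negbTE (eb1 i)) eqxx inE.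
have Se p : (c, flip e i, p) \notin S.
  by rewrite !(inE, xpair_eqE) !N (negbTE (eb0 i)) (negbTE (eb1 i)) !andbF.
have W1 p : p \in fan a1 a3 i -> (c, b1, p) \in W.
  by move=> h; rewrite inE /= /R !(N, eqxx) in_set h.
have W4 p : p \in fan e b4 i -> (~~ c, a4, p) \in W.
  by move=> h; rewrite inE /= /R !(N, eqxx).
have S1 p : (c, b1, p) \in S -> p = a3.
  by rewrite !(inE, xpair_eqE, eqxx) !N !(andbF, orbF) /= => /eqP.
have S4 p : (~~ c, a4, p) \in S -> p = b4.
  by rewrite !(inE, xpair_eqE, eqxx) !N !(andbF, orbF) /= => /eqP.
have C1 q : connect (tree_rel S W (flip a1 i == a2)) (c, b0, a1) (~~ c, al i, q).
  have aU : al i \in a1 |: fan a1 a2 i.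
    by rewrite /al; case: ifP; rewrite ?setU11 ?setU1r ?fan_start.
  apply: connect_trans (C0 _ aU) _.
  apply: connect_trans (cross_conn _ (Wn _) _) _.
  - by rewrite inE /= /R !eqxx.
  - by rewrite (negbTE (Sn _)) andbF orbT.
  exact: full_conn.
have C1' : (c, b1, al i) \in W ->
    connect (tree_rel S W (flip a1 i == a2)) (c, b0, a1) (c, b1, al i).
  move=> h; apply: connect_trans (C1 b1) (cross_conn_sym h (Wn _) _).
  by rewrite (negbTE (Sn _)) andbF orbT.
have C2 p : p \in fan a1 a3 i ->
    connect (tree_rel S W (flip a1 i == a2)) (c, b0, a1) (c, b1, p).
  move=> pf; apply: connect_trans (fan_cluster_conn _ W1 _ pf); last by move=> q _ /S1.
  move: C1'; rewrite /al; case: ifP => [a14 C1'|_ C1']; last exact/C1'/W1/fan_start.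
  have Wa : (c, b1, a1) \in W by rewrite inE /= /R !(N, eqxx) in_set a14 eqxx orbT.
  apply: connect_trans (C1' Wa) (flip_edge_conn Wa (W1 _ (fan_start _ _ _)) _).
  apply/orP; right; apply/negP => /andP[/S1-> /S1 /eqP].
  by rewrite (negbTE (flip_neq _ _)).
have C3 q : connect (tree_rel S W (flip a1 i == a2)) (c, b0, a1) (c, flip e i, q).
  apply: connect_trans (C1 (flip e i)) _.
  apply: connect_trans (cross_conn_sym (We _) (Wn _) _) _.
    by rewrite (negbTE (Sn _)) andbF orbT.
  exact: full_conn.
have C4 p : p \in fan e b4 i ->
    connect (tree_rel S W (flip a1 i == a2)) (c, b0, a1) (~~ c, a4, p).
  move=> pf; apply: connect_trans (C3 a4) _.
  apply: connect_trans (cross_conn (We _) (W4 _ (fan_start _ _ _)) _) _.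
    by rewrite (negbTE (Se _)) orbT.
  by apply: fan_cluster_conn pf => // q _ /S4.
move=> c' k p; rewrite {1}/R; case: (eqVneq c' c) => [->|cc].
  case: eqP => [-> /C0 //|_]; case: eqP => [->|_].
    rewrite in_set => /orP[/C2 //|/andP[a14 /eqP->]].
    move: C1'; rewrite /al a14; apply.
    by rewrite inE /= /R !(N, eqxx) in_set a14 eqxx orbT.
  by case: eqP => [-> _|_]; [apply: C3|rewrite inE].
have -> : c' = ~~ c by case: (c') (c) cc => [] [].
case: eqP => [-> /C4 //|_].
by case: eqP => [-> _|_]; [apply: C1|rewrite inE].
Qed.

(** The bridges to [a3] and [a4] are the clusters [(c, flip b0 i)], which differ from [b0]. If
    [flip a1 i] is [a3] or [a4], the tree crosses directly into that cluster at position [b0], moves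
    on to [flip b0 i] and from there to the bridge. *)
Lemma packable_two_opposite m (c : bool) (b0 a1 a2 a3 b3 a4 b4 : cube m) :
  a1 != a2 -> a3 != a4 ->
  packable [set (c, b0, a1); (c, b0, a2); (~~ c, a3, b3); (~~ c, a4, b4)].
Proof.
move=> a12 a34; set S := [set _; _; _; _].
have nc : (~~ c == c) = false by case: (c).
have cn : (c == ~~ c) = false by case: (c).
have a43 : a4 != a3 by rewrite eq_sym.
have N := (nc, cn, negbTE a34, negbTE a43).
pose reg i a b := [set p | (p \in fan b0 b i) || (flip a1 i == a) && (p == b0)].
pose R i c' k : {set cube m} :=
  if c' == c then
    if k == b0 then a1 |: fan a1 a2 i else
    if k == flip b0 i then setT else set0
  else
    if k == a3 then reg i a3 b3 else
    if k == a4 then reg i a4 b4 else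
    if k == flip a1 i then setT else set0.
have regI i j a b p : i != j -> p \in reg i a b -> p \in reg j a b -> p = b.
  move=> ij; rewrite !in_set => /orP[pi|/andP[/eqP ei /eqP pi]].
    move=> /orP[pj|/andP[_ /eqP pj]]; first exact: fan_disjoint ij pi pj.
    by move: pi; rewrite pj => /fan_avoid.
  move=> /orP[pj|/andP[/eqP ej _]]; first by move: pj; rewrite pi => /fan_avoid.
  by move: ij; rewrite (@flip_inj _ a1 i j) ?eqxx // ei ej.
apply: (@region_packable _ _ (c, b0, a1) (fun i => flip a1 i == a2) R).
- by rewrite !(inE, eqxx).
- move=> i c' k p; rewrite !inE => /orP[/orP[/orP[]|]|] /eqP[-> -> ->];
  by rewrite /R /reg !(N, eqxx) /= ?inE ?fan_end ?eqxx ?orbT.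
- move=> i j c' k p ij; rewrite /R; case: (eqVneq c' c) => [->|cc].
    case: (eqVneq k b0) => [->|_].
      move=> /setU1P[->|pi]; first by rewrite !(inE, eqxx).
      move=> /setU1P[->|pj]; first by rewrite !(inE, eqxx).
      by rewrite (fan_disjoint ij pi pj) !(inE, eqxx, orbT).
    case: (eqVneq k (flip b0 i)) => [->|_]; last by rewrite inE.
    case: (eqVneq (flip b0 i) (flip b0 j)) => [/flip_inj eij|_]; last by rewrite !inE.
    by rewrite eij eqxx in ij.
  have -> : c' = ~~ c by case: (c') (c) cc => [] [].
  case: (eqVneq k a3) => [->|_] => [pi pj|].
    by rewrite (regI _ _ _ _ _ ij pi pj) !(inE, eqxx, orbT).
  case: (eqVneq k a4) => [->|_] => [pi pj|].
    by rewrite (regI _ _ _ _ _ ij pi pj) !(inE, eqxx, orbT).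
  case: (eqVneq k (flip a1 i)) => [->|_]; last by rewrite inE.
  case: (eqVneq (flip a1 i) (flip a1 j)) => [/flip_inj eij|_]; last by rewrite !inE.
  by rewrite eij eqxx in ij.
- by move=> i j /eqP ei /eqP ej; apply: (@flip_inj _ a1); rewrite ei ej.
move=> i; set W := [set _ | _].
have W0 p : p \in a1 |: fan a1 a2 i -> (c, b0, p) \in W.
  by move=> h; rewrite inE /= /R !eqxx.
have S0 p : (c, b0, p) \in S -> p = a1 \/ p = a2.
  rewrite !(inE, xpair_eqE, eqxx) /= !N /= !orbF.
  by case/orP=> /eqP; [left|right].
have C0 p : p \in a1 |: fan a1 a2 i ->
    connect (tree_rel S W (flip a1 i == a2)) (c, b0, a1) (c, b0, p).
  exact: rooted_fan_conn.
have a1U : flip a1 i \in a1 |: fan a1 a2 i by rewrite setU1r ?fan_start.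
have We p : (c, flip b0 i, p) \in W.
  by rewrite inE /= /R eqxx (negbTE (flip_neq _ _)) eqxx inE.
have Se p : (c, flip b0 i, p) \notin S.
  by rewrite !(inE, xpair_eqE) !N (negbTE (flip_neq _ _)) !andbF.
(* [target] collects what is used about [a3] and [a4], so that one argument treats both. *)
pose target a b := [/\ forall p, p \in reg i a b -> (~~ c, a, p) \in W
  & forall p, (~~ c, a, p) \in S -> p = b].
have T3 : target a3 b3.
  split=> p; first by move=> h; rewrite inE /= /R !(N, eqxx).
  by rewrite !(inE, xpair_eqE, eqxx) !N !(andbF, orbF) /= => /eqP.
have T4 : target a4 b4.
  split=> p; first by move=> h; rewrite inE /= /R !(N, eqxx).
  by rewrite !(inE, xpair_eqE, eqxx) !N !(andbF, orbF) /= => /eqP.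
have Treg a b p : target a b -> p \in fan b0 b i -> (~~ c, a, p) \in W.
  by move=> [h _] pf; apply: h; rewrite in_set pf.
(* The edge used here may join two vertices of [S], but only in the tree that is allowed
   such edges. *)
have Cb a b : target a b -> flip a1 i = a ->
    connect (tree_rel S W (flip a1 i == a2)) (c, b0, a1) (~~ c, a, b0).
  move=> [Wa _] ea; rewrite -ea; apply: connect_trans (C0 _ a1U) (cross_conn (W0 _ a1U) _ _).
    by rewrite ea; apply: Wa; rewrite in_set ea !eqxx orbT.
  case: eqVneq => //= ne; apply/negP => /andP[/S0[]/eqP]; last by rewrite (negbTE ne).
  by rewrite (negbTE (flip_neq _ _)).
have Cvia a b q : target a b -> flip a1 i = a ->
    connect (tree_rel S W (flip a1 i == a2)) (c, b0, a1) (c, flip b0 i, q).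
  move=> T ea; have [Wa Sa] := T; apply: connect_trans (Cb a b T ea) _.
  have Wb := Treg _ _ _ T (fan_start b0 b i).
  apply: connect_trans (flip_edge_conn _ Wb _) _.
  - by apply: Wa; rewrite in_set ea !eqxx orbT.
  - apply/orP; right; apply/negP => /andP[/Sa-> /Sa /eqP].
    by rewrite (negbTE (flip_neq _ _)).
  apply: connect_trans (cross_conn_sym (We _) Wb _) _; last exact: full_conn.
  by rewrite (negbTE (Se _)) orbT.
have Cal q : flip a1 i != a3 -> flip a1 i != a4 ->
    connect (tree_rel S W (flip a1 i == a2)) (c, b0, a1) (~~ c, flip a1 i, q).
  move=> n3 n4.
  have Wn p : (~~ c, flip a1 i, p) \in W.
    by rewrite inE /= /R nc (negbTE n3) (negbTE n4) eqxx inE.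
  have Sn p : (~~ c, flip a1 i, p) \notin S.
    by rewrite !(inE, xpair_eqE) !N (negbTE n3) (negbTE n4) ?andbF.
  apply: connect_trans (C0 _ a1U) _.
  apply: connect_trans (cross_conn (W0 _ a1U) (Wn _) _) _; last exact: full_conn.
  by rewrite (negbTE (Sn _)) andbF orbT.
have C1 q : connect (tree_rel S W (flip a1 i == a2)) (c, b0, a1) (c, flip b0 i, q).
  case: (eqVneq (flip a1 i) a3) => [|n3]; first exact: (Cvia _ _ _ T3).
  case: (eqVneq (flip a1 i) a4) => [|n4]; first exact: (Cvia _ _ _ T4).
  apply: connect_trans (Cal (flip b0 i) n3 n4) _.
  apply: connect_trans (cross_conn_sym (We _) _ _) _; last exact: full_conn.
    by rewrite inE /= /R nc (negbTE n3) (negbTE n4) eqxx inE.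
  by rewrite (negbTE (Se _)) orbT.
have C2 a b p : target a b -> p \in reg i a b ->
    connect (tree_rel S W (flip a1 i == a2)) (c, b0, a1) (~~ c, a, p).
  move=> T; rewrite in_set => /orP[pf|/andP[/eqP ea /eqP->]]; last exact: Cb T ea.
  have Wb := Treg _ _ _ T (fan_start b0 b i).
  apply: connect_trans (C1 a) _.
  apply: connect_trans (cross_conn (We _) Wb _) _.
    by rewrite (negbTE (Se _)) orbT.
  by apply: fan_cluster_conn pf => q => [/(Treg _ _ _ T)//|_ /T.2].
move=> c' k p; rewrite {1}/R; case: (eqVneq c' c) => [->|cc].
  case: eqP => [-> /C0 //|_].
  by case: eqP => [-> _|_]; [apply: C1|rewrite inE].
have -> : c' = ~~ c by case: (c') (c) cc => [] [].
case: (eqVneq k a3) => [->|n3]; first exact: (C2 _ _ _ T3).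
case: (eqVneq k a4) => [->|n4]; first exact: (C2 _ _ _ T4).
by case: (eqVneq k (flip a1 i)) n3 n4 => [-> n3 n4 _|_]; [apply: Cal|rewrite inE].
Qed.

(** If [b0] and [b1] are not adjacent, [b0] itself serves. Otherwise the antipode of [b0] does: its
    distances [m] to [b0] and [m - 1] to [b1] are at least 2. *)
Lemma not_adjacent_center m (b0 b1 : cube m) : 3 <= m ->
  exists e : cube m, forall i, flip e i != b0 /\ flip e i != b1.
Proof.
move=> m3.
case: (boolP (cube_adj b0 b1)) => [/existsP[j /eqP b1E]|nadj]; last first.
  exists b0 => i; rewrite flip_neq; split=> //.
  by apply: contraNneq nadj => <-; apply: cube_adj_flip.
have ex i : exists k : 'I_m, (k != i) && (k != j).
  have : #|~: [set i; j]| > 0.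
    by have := cardsC [set i; j]; rewrite cards2 card_ord; case: (i != j) => /=; lia.
  by case/card_gt0P => k; rewrite !inE negb_or; exists k.
exists [ffun k => ~~ b0 k] => i; have [k /andP[ki kj]] := ex i.
by split; apply/eqP => /ffunP/(_ k);
  rewrite ?b1E !ffunE (negbTE ki) ?(negbTE kj) /=; case: (b0 k).
Qed.

Lemma packable_three_clusters m (x y z w : dvert m) : 3 <= m ->
  x != y -> x.1 = y.1 -> z.1 != x.1 -> w.1 != x.1 -> z.1 != w.1 ->
  packable [set x; y; z; w].
Proof.
move: x y z w => [[c b0] a1] [[c2 b2] a2] [[cz kz] pz] [[cw kw] pw] /= m3.
move=> xy [ec eb]; move: xy; rewrite -ec -eb !xpair_eqE !eqxx /= => a12.
have nb (d d' : bool) : d != d' -> d = ~~ d' by case: d d' => [] [].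
case: (eqVneq cz c) => [->|/nb->]; case: (eqVneq cw c) => [->|/nb->];
  rewrite ?eqxx /= => z0 w0 zw.
- exact: packable_three_alike.
- have [e eP] := not_adjacent_center b0 kz m3.
  by apply: (@packable_two_and_one _ _ _ _ e) a12 z0 _ _ => i; case: (eP i).
- have [e eP] := not_adjacent_center b0 kw m3.
  rewrite -setUA [X in _ :|: X]setUC setUA.
  by apply: (@packable_two_and_one _ _ _ _ e) a12 w0 _ _ => i; case: (eP i).
- exact: packable_two_opposite.
Qed.

(** * Transfer to bit strings *)

Definition low_bits n (v : dcvert n) : cube (n - 1) := [ffun j : 'I_(n - 1) => bit v j.+1].
Definition high_bits n (v : dcvert n) : cube (n - 1) := [ffun j : 'I_(n - 1) => bit v (n + j)].

(** A cluster is named by the half of the string that is fixed in it: the low bits in class 1, the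
    high bits in class 0. Changing the last bit thus swaps the two components. *)
Definition coords n (v : dcvert n) : dvert (n - 1) :=
  if lastbit v then (true, low_bits v, high_bits v)
  else (false, high_bits v, low_bits v).

Lemma bit_position n p : 0 < p <= 2 * n - 1 ->
  [\/ exists j : 'I_(n - 1), p = j.+1, exists j : 'I_(n - 1), p = n + j | p = 2 * n - 1].
Proof.
move=> hp; case: (ltnP p n) => [pn|np].
  have h : p.-1 < n - 1 by lia.
  by apply: Or31; exists (Ordinal h) => /=; lia.
case: (ltnP p (2 * n - 1)) => [pn|np']; last by apply: Or33; lia.
have h : p - n < n - 1 by lia.
by apply: Or32; exists (Ordinal h) => /=; lia.
Qed.

Lemma coords_inj n : injective (@coords n).
Proof.
move=> u v; rewrite /coords => E.
have [l h b] : [/\ low_bits u = low_bits v, high_bits u = high_bits v & lastbit u = lastbit v].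
  by move: E; case: (lastbit u); case: (lastbit v) => // -[-> ->].
apply: eq_from_tnth => i; rewrite !(tnth_nth false).
have := @bit_position n i.+1 (ltn_ord i); rewrite -[nth _ u _]/(bit u i.+1) -[nth _ v _]/(bit v i.+1).
case=> [[j ->]|[j ->]|->]; last exact: b.
  by have := congr1 (fun f : cube _ => f j) l; rewrite !ffunE.
by have := congr1 (fun f : cube _ => f j) h; rewrite !ffunE.
Qed.

Lemma coords_bij n : 0 < n -> bijective (@coords n).
Proof.
move=> n0; apply: inj_card_bij; first exact: coords_inj.
rewrite !card_prod !card_ffun card_bool card_ord card_tuple card_bool.
by rewrite -expnS -expnD; apply: eq_leq; congr (2 ^ _); lia.
Qed.

Lemma same_clusterE n (u v : dcvert n) :
  same_cluster u v = ((coords u).1 == (coords v).1).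
Proof.
rewrite /same_cluster /coords; case: (lastbit u); case: (lastbit v) => //=;
  rewrite xpair_eqE /=; apply/forallP/eqP => [h|h i].
- apply/ffunP => j; rewrite !ffunE.
  have hj : j < 2 * n - 1 by have := ltn_ord j; lia.
  have /implyP := h (Ordinal hj); rewrite /= => /(_ _)/eqP; apply.
  by have := ltn_ord j; lia.
- apply/implyP => hi; have hj : i < n - 1 by lia.
  by have := congr1 (fun f : cube _ => f (Ordinal hj)) h; rewrite !ffunE /= => ->.
- apply/ffunP => j; rewrite !ffunE.
  have hj : n + j - 1 < 2 * n - 1 by have := ltn_ord j; lia.
  have /implyP := h (Ordinal hj); rewrite /=.
  have -> : (n + j - 1).+1 = n + j by have := ltn_ord j; lia.
  by move=> /(_ _)/eqP; apply; have := ltn_ord j; lia.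
- apply/implyP => hi; have hj : i.+1 - n < n - 1 by lia.
  have := congr1 (fun f : cube _ => f (Ordinal hj)) h; rewrite !ffunE /=.
  by have -> : n + (i.+1 - n) = i.+1 by [lia]; move=> ->.
Qed.

Lemma cluster_eqE n (u v : dcvert n) :
  (cluster u == cluster v) = ((coords u).1 == (coords v).1).
Proof.
apply/eqP/eqP => [/setP/(_ u)|h]; last first.
  by apply/setP => t; rewrite !inE !same_clusterE h.
by rewrite !inE !same_clusterE eqxx => /esym/eqP.
Qed.

Lemma dc_adjI n (u v : dcvert n) p :
  0 < p <= 2 * n - 1 ->
  (forall q, 0 < q <= 2 * n - 1 -> (bit u q != bit v q) = (q == p)) ->
  (p <= n - 1 -> ~~ lastbit u && ~~ lastbit v) ->
  (n <= p <= 2 * n - 2 -> lastbit u && lastbit v) ->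
  dc_adj u v.
Proof.
move=> hp hq h0 h1; have hi : p.-1 < 2 * n - 1 by lia.
apply/existsP; exists (Ordinal hi) => /=.
have -> : p.-1.+1 = p by lia.
apply/and3P; split; [|exact/implyP|exact/implyP].
apply/forallP => j; rewrite hq ?ltn_ord // -val_eqE /=.
by apply/eqP; apply/eqP/eqP; lia.
Qed.

(** Flipping cube coordinate [i] changes string position [n + i] in class 1 and [i + 1] in class 0;
    a cross edge keeps both halves and changes only position [2 * n - 1]. *)
Lemma dadj_coords n (u v : dcvert n) :
  0 < n -> dadj (coords u) (coords v) -> dc_adj u v.
Proof.
move=> n0.
have lo (t : dcvert n) (j : 'I_(n - 1)) : bit t j.+1 = low_bits t j by rewrite ffunE.
have hi (t : dcvert n) (j : 'I_(n - 1)) : bit t (n + j) = high_bits t j by rewrite ffunE.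
rewrite /coords /dadj; case lu: (lastbit u); case lv: (lastbit v) => /=.
- move=> /andP[/eqP e /existsP[i /eqP f]]; have li := ltn_ord i.
  apply: (@dc_adjI _ _ _ (n + i)); [lia| |lia|by rewrite lu lv].
  move=> q /bit_position[[j ->]|[j ->]|->].
  + by rewrite !lo e eqxx; have := ltn_ord j; lia.
  + rewrite !hi f [flip _ _ _]ffunE eqn_add2l (_ : (j == i :> nat) = (j == i)) //.
    by case: (j == i); case: (high_bits u j).
  + by rewrite -[bit u _]/(lastbit u) -[bit v _]/(lastbit v) lu lv eqxx; lia.
- move=> /andP[/eqP e /eqP f].
  apply: (@dc_adjI _ _ _ (2 * n - 1)); [lia| |lia|lia].
  move=> q /bit_position[[j ->]|[j ->]|->].
  + by rewrite !lo f eqxx; have := ltn_ord j; lia.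
  + by rewrite !hi e eqxx; have := ltn_ord j; lia.
  + by rewrite -[bit u _]/(lastbit u) -[bit v _]/(lastbit v) lu lv !eqxx.
- move=> /andP[/eqP e /eqP f].
  apply: (@dc_adjI _ _ _ (2 * n - 1)); [lia| |lia|lia].
  move=> q /bit_position[[j ->]|[j ->]|->].
  + by rewrite !lo e eqxx; have := ltn_ord j; lia.
  + by rewrite !hi f eqxx; have := ltn_ord j; lia.
  + by rewrite -[bit u _]/(lastbit u) -[bit v _]/(lastbit v) lu lv !eqxx.
- move=> /andP[/eqP e /existsP[i /eqP f]]; have li := ltn_ord i.
  apply: (@dc_adjI _ _ _ i.+1); [lia| |by rewrite lu lv|lia].
  move=> q /bit_position[[j ->]|[j ->]|->].
  + rewrite !lo f [flip _ _ _]ffunE eqSS (_ : (j == i :> nat) = (j == i)) //.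
    by case: (j == i); case: (low_bits u j).
  + by rewrite !hi e eqxx; have := ltn_ord j; lia.
  + by rewrite -[bit u _]/(lastbit u) -[bit v _]/(lastbit v) lu lv eqxx; lia.
Qed.

Lemma trees_of_packable n (S : {set dcvert n}) :
  0 < n -> packable (@coords n @: S) ->
  exists T : 'I_(n - 1) -> subgraph n, internally_disjoint_S_trees S T.
Proof.
move=> n0 [x [W [F [xS SW WW FF con]]]].
have [g gK Kg] := coords_bij n0.
have memS u : (coords u \in @coords n @: S) = (u \in S) by rewrite mem_imset //; exact: coords_inj.
apply: (@trees_of_connected_sets _ _ _ (g x) (fun i => [set v | coords v \in W i]) F) => //.
- by rewrite -memS Kg.
- by move=> i; apply/subsetP => u; rewrite inE -memS => /(subsetP (SW i)).
- move=> i j ij; apply/setP => u; rewrite !inE -memS.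
  apply/idP/idP => [h|h]; first by apply: (subsetP (WW i j ij)); rewrite inE.
  by rewrite !(subsetP (SW _)).
move=> i u; rewrite inE => /con; rewrite -{2}[u]gK.
apply: connect_homo => a b; rewrite /tree_rel => /and4P[aW bW ab h].
apply: connect1; rewrite /= !inE !Kg aW bW -!memS !Kg h andbT /=.
by apply: dadj_coords; rewrite ?Kg.
Qed.

(** * Choice of the pair in a common cluster *)

Lemma card3_eq_pair (T : finType) (a b c : T) :
  #|[set a; a; b; c]| = 3 -> [/\ b != a, c != a & b != c].
Proof.
rewrite setUid -setUA cardsU1 cards2 !inE negb_or ![a == _]eq_sym.
by case: (b != a); case: (c != a); case: (b != c).
Qed.

Lemma trees_same_cluster n (x y z w : dcvert n) :
  4 <= n -> x != y -> cluster x = cluster y ->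
  #|(@cluster n) @: [set x; y; z; w]| = 3 ->
  exists T : 'I_(n - 1) -> subgraph n,
    internally_disjoint_S_trees [set x; y; z; w] T.
Proof.
move=> n4 xy cxy; rewrite !imsetU !imset_set1 -cxy => /card3_eq_pair.
rewrite !cluster_eqE => -[zx wx zw].
apply: trees_of_packable; first lia.
rewrite !imsetU !imset_set1; apply: packable_three_clusters => //; first lia.
  by rewrite (inj_eq (@coords_inj n)).
by apply/eqP; rewrite -cluster_eqE cxy.
Qed.

Theorem mainTheorem4 (n : nat) (x y z w : dcvert n) :
  4 <= n ->
  uniq [:: x; y; z; w] ->
  #|(@cluster n) @: [set x; y; z; w]| = 3 ->
  exists T : 'I_(n - 1) -> subgraph n,
    internally_disjoint_S_trees [set x; y; z; w] T.
Proof.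
move=> n4; rewrite /= !inE !negb_or => /and4P[/and3P[xy xz xw] /andP[yz yw] zw _] c3.
(* The claim depends on [S] only as a set, so any pair in a common cluster may be listed first. *)
have perm (a b c d : dcvert n) : [set x; y; z; w] = [set a; b; c; d] ->
    a != b -> cluster a = cluster b ->
    exists T : 'I_(n - 1) -> subgraph n,
      internally_disjoint_S_trees [set x; y; z; w] T.
  by move=> E ab cab; rewrite E in c3 *; apply: trees_same_cluster.
case: (eqVneq (cluster x) (cluster y)) => [cxy|cxy]; first exact: trees_same_cluster n4 xy cxy c3.
case: (eqVneq (cluster x) (cluster z)) => [cxz|cxz].
  by apply: (perm x z y w _ xz cxz); apply/setP => v; rewrite !inE; do 4 case: (v == _).
case: (eqVneq (cluster x) (cluster w)) => [cxw|cxw].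
  by apply: (perm x w y z _ xw cxw); apply/setP => v; rewrite !inE; do 4 case: (v == _).
case: (eqVneq (cluster y) (cluster z)) => [cyz|cyz].
  by apply: (perm y z x w _ yz cyz); apply/setP => v; rewrite !inE; do 4 case: (v == _).
case: (eqVneq (cluster y) (cluster w)) => [cyw|cyw].
  by apply: (perm y w x z _ yw cyw); apply/setP => v; rewrite !inE; do 4 case: (v == _).
case: (eqVneq (cluster z) (cluster w)) => [czw|czw].
  by apply: (perm z w x y _ zw czw); apply/setP => v; rewrite !inE; do 4 case: (v == _).
(* If no pair shared a cluster, there would be four clusters. *)
move: c3; rewrite !imsetU !imset_set1 -!setUA !cardsU1 cards1 !inE.
by rewrite (negbTE cxy) (negbTE cxz) (negbTE cxw) (negbTE cyz) (negbTE cyw) (negbTE czw).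
Qed.
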